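(* Let $b_1,b_2\in[0,1]$, $n\in\mathbb{Z}_{\ge1}$, $m\in\{1,\dots,n\}$ and $\mathfrak{i},\mathfrak{j},\mathfrak{k},\mathfrak{l}\in\{0,1\}^m$. For all $\mathbf{i},\mathbf{j}\in\{0,1\}^n$ such that $\mathbf{i}_{[1,m]}=\mathfrak{i}$ and $\mathbf{j}_{[1,m]}=\mathfrak{j}$, we have $$\sum_{\substack{\mathbf{k},\mathbf{l}\in\{0,1\}^n:\\ \mathbf{k}_{[1,m]}=\mathfrak{k},\ \mathbf{l}_{[1,m]}=\mathfrak{l}}}\mathsf{L}^n(\mathbf{i},\mathbf{j};\mathbf{k},\mathbf{l})=\mathsf{L}^m(\mathfrak{i},\mathfrak{j};\mathfrak{k},\mathfrak{l}).$$
   Context: For $\mathbf{x}=(x_1,\dots,x_n)$, $\mathbf{x}_{[1,m]}=(x_1,\dots,x_m)$. Boolean-type product. Regard $b_1,b_2$ as indeterminates and let $W'=\{0,1,b_1,b_2,1-b_1,1-b_2\}$ and $W=W'\cup\{b_1b_2,\,b_1(1-b_2),\,(1-b_1)b_2,\,(1-b_1)(1-b_2)\}$. For $x\in W$ let $[x]$ be its set of factors: $[x]=\{x\}$ if $x\in W'$, $[b_1b_2]=\{b_1,b_2\}$, $[b_1(1-b_2)]=\{b_1,1-b_2\}$, $[(1-b_1)b_2]=\{1-b_1,b_2\}$, $[(1-b_1)(1-b_2)]=\{1-b_1,1-b_2\}$. For $x,y\in W$ set $x*y=0$ if $\{b_1,1-b_1\}\subseteq[x]\cup[y]$ or $\{b_2,1-b_2\}\subseteq[x]\cup[y]$,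 and $x*y=\prod_{z\in[x]\cup[y]}z$ otherwise. The product $*$ is commutative and associative on $W$; $\prod^*$ denotes the product of several terms under $*$. Matrix $\mathsf{L}^1$ (indexed by $i,j,k,l\in\{0,1\}$, the numbers of lines at the bottom, left, top, right of a vertex): $\mathsf{L}^1(1,0;1,0)=1$, $\mathsf{L}^1(0,1;0,1)=1$, $\mathsf{L}^1(0,0;0,0)=b_2$, $\mathsf{L}^1(0,0;1,1)=1-b_2$, $\mathsf{L}^1(1,1;1,1)=b_1$, $\mathsf{L}^1(1,1;0,0)=1-b_1$, and all other entries are $0$. For $\mathbf{x}\in\{0,1\}^n$ and $r\in\{1,\dots,n\}$ let $\mathfrak{s}_r(\mathbf{x})=\big(\sum_{q=1}^r x_q\big)\bmod 2\in\{0,1\}$. For $\mathbf{i},\mathbf{j},\mathbf{k},\mathbf{l}\in\{0,1\}^n$ define $$\mathsf{L}^n(\mathbf{i},\mathbf{j};\mathbf{k},\mathbf{l})=\prod^{*}_{r\in\{1,\dots,n\}}\mathsf{L}^1\big(\mathfrak{s}_r(\mathbf{i}),\mathfrak{s}_r(\mathbf{j});\mathfrak{s}_r(\mathbf{k}),\mathfrak{s}_r(\mathbf{l})\big)\in W;$$ the product $*$ is computed formally in $W$, and the resulting element is then evaluated at the given numbers $b_1,b_2\in[0,1]$. *)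

(* Defs.v *)
From mathcomp Require Import all_boot all_order all_algebra finmap.
From mathcomp Require Import mpoly.

Set Implicit Arguments.
Unset Strict Implicit.
Unset Printing Implicit Defensive.

Import Order.TTheory GRing.Theory Num.Theory.
Local Open Scope ring_scope.
Local Open Scope fset_scope.

Definition B1 (R : realFieldType) : {mpoly R[2]} := 'X_ord0.
Definition B2 (R : realFieldType) : {mpoly R[2]} := 'X_ord_max.

Definition B1c (R : realFieldType) : {mpoly R[2]} := 1 - B1 R.
Definition B2c (R : realFieldType) : {mpoly R[2]} := 1 - B2 R.

Definition W' (R : realFieldType) : seq {mpoly R[2]} :=
  [:: 0; 1; B1 R; B2 R; B1c R; B2c R].

Definition W (R : realFieldType) : seq {mpoly R[2]} :=
  W' R ++ [:: B1 R * B2 R; B1 R * B2c R; B1c R * B2 R; B1c R * B2c R].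

(* The set [x]; only meaningful for x in W (elsewhere it is {x}). *)
Definition factors (R : realFieldType) (x : {mpoly R[2]}) :
    {fset {mpoly R[2]}} :=
  if x == B1 R * B2 R then [fset B1 R; B2 R]
  else if x == B1 R * B2c R then [fset B1 R; B2c R]
  else if x == B1c R * B2 R then [fset B1c R; B2 R]
  else if x == B1c R * B2c R then [fset B1c R; B2c R]
  else [fset x].

(* The product * of W, extended to all polynomials by the same formula; it is
   only used on W, which is closed under it. *)
Definition star (R : realFieldType) (x y : {mpoly R[2]}) : {mpoly R[2]} :=
  let F := factors x `|` factors y in
  if ([fset B1 R; B1c R] `<=` F) || ([fset B2 R; B2c R] `<=` F) then 0
  else \prod_(z <- F) z.

Definition L1 (R : realFieldType) (i j k l : bool) : {mpoly R[2]} :=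
  match i, j, k, l with
  | true,  false, true,  false => 1
  | false, true,  false, true  => 1
  | false, false, false, false => B2 R
  | false, false, true,  true  => B2c R
  | true,  true,  true,  true  => B1 R
  | true,  true,  false, false => B1c R
  | _, _, _, _ => 0
  end.

(* Indices are 0-based: psum r x is s_{r+1}(x). *)
Definition psum (n : nat) (r : 'I_n) (x : {ffun 'I_n -> bool}) : bool :=
  odd (\sum_(q < n | (q <= r)%N) x q).

(* The element of W, before evaluation. *)
Definition Lformal (R : realFieldType) (n : nat)
    (i j k l : {ffun 'I_n -> bool}) : {mpoly R[2]} :=
  \big[@star R/1]_(r < n)
    L1 R (psum r i) (psum r j) (psum r k) (psum r l).

Definition L (R : realFieldType) (b1 b2 : R) (n : nat)
    (i j k l : {ffun 'I_n -> bool}) : R :=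
  (Lformal R i j k l).@[tnth [tuple b1; b2]].

Definition restr (m n : nat) (hmn : (m <= n)%N) (x : {ffun 'I_n -> bool}) :
    {ffun 'I_m -> bool} :=
  [ffun q : 'I_m => x (widen_ord hmn q)].

(* Main.v *)
Require Import Defs.
From HB Require Import structures.
From mathcomp Require Import all_boot all_order all_algebra.
From mathcomp Require Import finmap mpoly ring.

Set Implicit Arguments.
Unset Strict Implicit.
Unset Printing Implicit Defensive.

Import Order.TTheory GRing.Theory Num.Theory.
Local Open Scope ring_scope.

(** Elements of [W] are polynomials of degree at most one in each of [b1] and
    [b2], so their value at [(b1, b2)] is the average of their values at the
    four corners of the square [{0,1}^2], a corner being drawn by two
    independent Bernoulli variables of parameters [b1] and [b2]
    ([eval_corners]).  At a corner every element of [W'] is [0] or [1], hence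
    idempotent, and the rule that a repeated factor counts once while
    [b * (1 - b) = 0] turns [*] into the usual product ([corner_star]).
    Thus [L^n] is a mixture, with weights that depend neither on [n] nor on the
    configurations, of the four products of one-colour matrices at the corners
    ([L_corners]).

    At a corner the one-colour vertex is deterministic: the inputs [(i, j)]
    determine the outputs [(k, l)] ([corner_L1]).  Since a configuration is
    determined by its parity partial sums ([psums_inj]), the product over the
    [n] levels is the indicator that the partial sums of [k] and [l] are
    prescribed functions of those of [i] and [j] ([prod_L1]).  Exactly one [k]
    and one [l] satisfy this.  As the first [m] partial sums involve only the
    first [m] entries, the sum over the extensions of [k0] and [l0] keeps this
    one pair precisely when [k0] and [l0] are the outputs of [i0] and [j0]
    ([restr_outputs]). *)

(** * Evaluation of the Boolean-type product *)

Lemma fsubset2 (K : choiceType) (a b : K) (F : {fset K}) :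
  ([fset a; b] `<=` F)%fset = (a \in F) && (b \in F).
Proof. by rewrite fsubUset !fsub1set. Qed.

(** The nonzero elements of [W] are the products of at most one choice among
    [b1], [1 - b1] and at most one among [b2], [1 - b2]; hence a set of factors
    without a clash has its product in [W].  An abstract ring is used because
    comparing concrete polynomials by conversion is expensive. *)
Lemma prod_no_clash (A : comNzRingType) (u v uc vc : A) (pu puc pv pvc : bool) :
  ~~ (pu && puc) -> ~~ (pv && pvc) ->
  (if pu then u else 1) * ((if pv then v else 1) *
    ((if puc then uc else 1) * (if pvc then vc else 1)))
  \in [:: 0; 1; u; v; uc; vc; u * v; u * vc; uc * v; uc * vc].
Proof.
case: pu; case: puc; case: pv; case: pvc => //= _ _;
by rewrite ?mul1r ?mulr1 ?(mulrC v uc) !inE eqxx ?orbT.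
Qed.

Section Evaluation.

Variable R : realFieldType.
Implicit Types (x y z : {mpoly R[2]}) (e : bool * bool).

Definition eval (b1 b2 : R) : {mpoly R[2]} -> R :=
  meval (tnth [tuple b1; b2]).

Definition corner e : {mpoly R[2]} -> R := eval e.1%:R e.2%:R.

HB.instance Definition _ b1 b2 := GRing.RMorphism.on (eval b1 b2).
HB.instance Definition _ e := GRing.RMorphism.on (corner e).

Lemma eval_B1 b1 b2 : eval b1 b2 (B1 R) = b1.
Proof. by rewrite /eval mevalXU. Qed.

Lemma eval_B2 b1 b2 : eval b1 b2 (B2 R) = b2.
Proof. by rewrite /eval mevalXU. Qed.

Lemma eval_B1c b1 b2 : eval b1 b2 (B1c R) = 1 - b1.
Proof. by rewrite rmorphB rmorph1 /= eval_B1. Qed.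

Lemma eval_B2c b1 b2 : eval b1 b2 (B2c R) = 1 - b2.
Proof. by rewrite rmorphB rmorph1 /= eval_B2. Qed.

Definition evalE := (eval_B1, eval_B2, eval_B1c, eval_B2c).

(* Conversion must not unfold the indeterminates into monomials. *)
Local Opaque B1 B2 B1c B2c.

(** Distinctness of the six factors is what makes the sets [factors x] have the
    expected number of elements. *)
Lemma uniq_W' : uniq (W' R).
Proof.
(* The point (3, 5) separates the six elements. *)
apply: (@map_uniq _ _ (eval 3 5)).
have -> : map (eval 3 5) (W' R) = map intr [:: 0; 1; 3; 5; -2; -4 : int].
  by rewrite /W' /= rmorph0 rmorph1 !evalE; congr [:: _; _; _; _; _; _]; ring.
by rewrite map_inj_uniq //; apply: intr_inj.
Qed.

Lemma factors_sub_W' x : x \in W R -> {subset factors x <= W' R}.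
Proof.
rewrite /W mem_cat mem_seq4 => Wx z; rewrite /factors; move: Wx.
do 4![case: eqP => [_ _|_];
  first by rewrite in_fset2 => /orP[]/eqP->; rewrite !inE eqxx ?orbT].
by rewrite !orbF => Wx; rewrite inE => /eqP->.
Qed.

Lemma prod_factors x : \prod_(z <- factors x) z = x.
Proof.
have prod2 y z : y != z -> \prod_(t <- [fset y; z]%fset) t = y * z.
  by move=> yz; rewrite big_fsetU1 ?inE //= big_seq_fset1.
have := uniq_W'; rewrite /W' /= !inE !negb_or.
move=> /and5P[_ _ /and3P[n12 _ n12c] /andP[n21c _] /andP[ncc _]].
rewrite /factors; do 4![case: eqP => [->|_]; first by rewrite prod2 // eq_sym].
by rewrite big_seq_fset1.
Qed.

Lemma prod_sub_W' (F : {fset {mpoly R[2]}}) : {subset F <= W' R} ->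
  \prod_(z <- F) z = \prod_(z <- W' R | z \in F) z.
Proof.
move=> FW; rewrite -[RHS]big_filter; apply: perm_big; apply: uniq_perm => //.
  exact/filter_uniq/uniq_W'.
by move=> z; rewrite mem_filter; case: (boolP (z \in F)) => // /FW ->.
Qed.

Lemma star_W x y : x \in W R -> y \in W R -> star x y \in W R.
Proof.
move=> Wx Wy; rewrite /star; set F := (factors x `|` factors y)%fset.
have FW : {subset F <= W' R}.
  by move=> z; rewrite inE => /orP[/(factors_sub_W' Wx)|/(factors_sub_W' Wy)].
have W0 : 0 \in W R := mem_nth 0 (isT : 0 < size (W R))%N.
case: ifPn => [_|/norP[nc1 nc2]]; first exact: W0.
rewrite fsubset2 in nc1; rewrite fsubset2 in nc2.
have step z s : \prod_(t <- z :: s | t \in F) t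
    = (if z \in F then z else 1) * \prod_(t <- s | t \in F) t.
  by rewrite big_cons; case: ifP; rewrite ?mul1r.
rewrite (prod_sub_W' FW) /W' !step big_nil.
case: (0 \in F); first by rewrite mul0r.
rewrite mul1r if_same mul1r mulr1; exact: prod_no_clash.
Qed.

Lemma corner_idem e z : z \in W' R -> corner e z * corner e z = corner e z.
Proof.
rewrite !inE /corner; case: e => e1 e2.
by do 5?[case/orP]; move=> /eqP->; rewrite ?rmorph0 ?rmorph1 ?evalE;
  case: e1; case: e2; rewrite /= ?subrr ?subr0 ?mulr0 ?mulr1.
Qed.

(** Both deviations of [*] from the product are invisible at a corner: repeated
    factors are idempotent there, and [b * (1 - b)] vanishes. *)
Lemma corner_star e x y : x \in W R -> y \in W R ->
  corner e (star x y) = corner e x * corner e y.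
Proof.
move=> /factors_sub_W' Fx /factors_sub_W' Fy.
have FW : {subset (factors x `|` factors y)%fset <= W' R}.
  by move=> z; rewrite inE => /orP[/Fx|/Fy].
have -> : corner e x * corner e y
          = corner e (\prod_(z <- (factors x `|` factors y)%fset) z).
  rewrite -[x in LHS]prod_factors -[y in LHS]prod_factors !prod_sub_W' //.
  rewrite !rmorph_prod /= big_mkcond [X in _ * X]big_mkcond [RHS]big_mkcond.
  rewrite -big_split /=.
  apply: eq_big_seq => z Wz; rewrite inE.
  by case: ifP; case: ifP => //= _ _; rewrite ?mul1r ?mulr1 ?corner_idem.
rewrite /star; set F := (factors x `|` factors y)%fset.
have prod0 u v : u != v -> u \in F -> v \in F -> corner e u * corner e v = 0 ->
    corner e (\prod_(z <- F) z) = 0.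
  move=> uv uF vF uv0; rewrite rmorph_prod /=.
  have vFu : v \in (F `\ u)%fset.
    by apply/fsetD1P; split; [rewrite eq_sym | exact: vF].
  by rewrite (big_fsetD1 u uF) (big_fsetD1 v vFu) /= mulrA uv0 mul0r.
have [n11c n22c] : B1 R != B1c R /\ B2 R != B2c R.
  have := uniq_W'; rewrite /W' /= !inE !negb_or.
  by move=> /and5P[_ _ /and3P[_ n11c _] /andP[_ n22c] _].
case: ifP => [|_]; last by [].
rewrite rmorph0 => /orP[]; rewrite fsubset2 => /andP[uF vF].
  rewrite (prod0 _ _ n11c uF vF) // /corner !evalE.
  by case: (e.1); rewrite ?subrr ?mulr0 ?mul0r.
rewrite (prod0 _ _ n22c uF vF) // /corner !evalE.
by case: (e.2); rewrite ?subrr ?mulr0 ?mul0r.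
Qed.

Definition bernoulli (b : R) (t : bool) : R := if t then b else 1 - b.

Definition weight (b1 b2 : R) e : R := bernoulli b1 e.1 * bernoulli b2 e.2.

(** Interpolation of a polynomial that is affine in each variable. *)
Lemma eval_corners b1 b2 x : x \in W R ->
  eval b1 b2 x = \sum_e weight b1 b2 e * corner e x.
Proof.
move=> Wx.
rewrite -(pair_bigA _ (fun s t => weight b1 b2 (s, t) * corner (s, t) x)) /=.
rewrite !big_bool /weight /corner /=; move: Wx; rewrite !inE.
by do 9?[case/orP]; move=> /eqP->;
  rewrite ?rmorph0 ?rmorph1 ?rmorphM /= ?evalE /=; ring.
Qed.

Lemma W1 : 1 \in W R.
Proof. exact: (mem_nth 0 (isT : 1 < size (W R))%N). Qed.

Lemma L1_W i j k l : L1 R i j k l \in W R.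
Proof.
rewrite /L1 /W mem_cat /W'; apply/orP; left.
move: (B1 R) (B2 R) (B1c R) (B2c R) => u v uc vc.
by case: i; case: j; case: k; case: l; rewrite !inE eqxx ?orbT.
Qed.

Lemma L_corners b1 b2 n (i j k l : {ffun 'I_n -> bool}) :
  L b1 b2 i j k l = \sum_e weight b1 b2 e *
    \prod_(r < n)
      corner e (L1 R (psum r i) (psum r j) (psum r k) (psum r l)).
Proof.
rewrite -[LHS]/(eval b1 b2 (Lformal R i j k l)) eval_corners; last first.
  apply: (big_ind (fun x => x \in W R)) => [|x y|r _];
    [exact: W1 | exact: star_W | exact: L1_W].
apply: eq_bigr => e _; congr (_ * _).
(* Membership in [W] is carried along: [*] is multiplicative only there. *)
pose P x c := x \in W R /\ corner e x = c.
suff [] : P (Lformal R i j k l) (\prod_(r < n)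
    corner e (L1 R (psum r i) (psum r j) (psum r k) (psum r l))) by [].
apply: (big_rec2 P) => [|r c x _ [Wx <-]].
  by split; [exact: W1 | rewrite rmorph1].
by split; [apply: star_W | rewrite corner_star]; rewrite ?L1_W.
Qed.

(** * Determinism at the corners *)

(** The output of a line that meets a vertex in state [s] while the other input
    is [t].  The vertex is symmetric in its two lines: a line that
    arrives alone goes straight, and equal inputs are both kept or both
    flipped.  The corner [(1, 1)] keeps every input. *)
Definition out e (s t : bool) : bool :=
  if s == t then (if s then e.1 else ~~ e.2) else s.

Lemma corner_L1 e i j k l :
  corner e (L1 R i j k l) = ((k == out e i j) && (l == out e j i))%:R.
Proof.
case: e => e1 e2; rewrite /corner.
by case: i; case: j; case: k; case: l; rewrite ?rmorph0 ?rmorph1 ?evalE /out;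
  case: e1; case: e2; rewrite /= ?subrr ?subr0.
Qed.

End Evaluation.

(** * Parity partial sums *)

Section PartialSums.

Variable n : nat.
Implicit Types x y : {ffun 'I_n -> bool}.

Definition psums x : {ffun 'I_n -> bool} := [ffun r => psum r x].

(** The entry at [r] is the parity of the partial sum at [r] minus the earlier
    entries, so the entries are recovered one after the other. *)
Lemma psums_inj : injective psums.
Proof.
move=> x y /ffunP exy; apply/ffunP => r.
have [p] := ubnP (nat_of_ord r); elim: p r => // p IH r; rewrite ltnS => ler.
have := exy r; rewrite !ffunE /psum (bigD1 r) //=.
rewrite [X in _ = odd X](bigD1 r) //= !oddD !oddb.
rewrite (eq_bigr (fun q => nat_of_bool (y q))) => [/addIb //|q /andP[leq ne]].
by rewrite IH // (leq_trans _ ler) // ltn_neqAle leq andbT.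
Qed.

Definition psums_inv : {ffun 'I_n -> bool} -> {ffun 'I_n -> bool} :=
  invF psums_inj.

Lemma eq_psums x y : (psums x == y) = (x == psums_inv y).
Proof.
by apply/eqP/eqP => [<-|->]; rewrite /psums_inv ?invF_f ?f_invF.
Qed.

End PartialSums.

Lemma restr_psums n m (hmn : (m <= n)%N) (x : {ffun 'I_n -> bool}) :
  restr hmn (psums x) = psums (restr hmn x).
Proof.
apply/ffunP => r; rewrite !ffunE /psum; congr odd.
have rm q : (q <= r)%N -> (q < m)%N by move/leq_ltn_trans; apply.
rewrite (eq_bigl (fun q : 'I_n => (q <= r)%N && (q < m)%N)); last first.
  by move=> q; case: (boolP (q <= r)%N) => [/rm ->|].
by rewrite (big_ord_narrow_cond hmn); apply: eq_bigr => q _; rewrite ffunE.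
Qed.

(** * Summation over the extensions *)

(** At a corner the vertex acts on partial sums level by level, so the outgoing
    configuration is read off after inverting the bijection [psums]. *)
Definition outputs n (e : bool * bool) (i j : {ffun 'I_n -> bool}) :
    {ffun 'I_n -> bool} :=
  psums_inv [ffun r => out e (psum r i) (psum r j)].

(** The dynamics at a corner is projective: [out] acts on each level separately
    and [psums] is triangular, so later entries never influence earlier ones. *)
Lemma restr_outputs n m (hmn : (m <= n)%N) e (i j : {ffun 'I_n -> bool}) :
  restr hmn (outputs e i j) = outputs e (restr hmn i) (restr hmn j).
Proof.
apply/eqP; rewrite -eq_psums -restr_psums /psums_inv f_invF.
apply/eqP/ffunP => r; rewrite !ffunE.
have psumE (x : {ffun 'I_n -> bool}) :
    psum (widen_ord hmn r) x = psum r (restr hmn x).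
  by have /ffunP/(_ r) := restr_psums hmn x; rewrite !ffunE.
by rewrite !psumE.
Qed.

Lemma prod_L1 (R : realFieldType) n e (i j k l : {ffun 'I_n -> bool}) :
  \prod_(r < n) corner e (L1 R (psum r i) (psum r j) (psum r k) (psum r l))
  = (k == outputs e i j)%:R * (l == outputs e j i)%:R.
Proof.
have indicator (x y z : {ffun 'I_n -> bool}) :
    (x == outputs e y z)%:R
    = \prod_(r < n) (psum r x == out e (psum r y) (psum r z))%:R :> R.
  rewrite -eq_psums; case: eqP => [/ffunP exy|nexy].
    by rewrite big1 // => r _; have := exy r; rewrite !ffunE => ->; rewrite eqxx.
  have [r nr] : exists r, psum r x != out e (psum r y) (psum r z).
    apply/existsP; apply: contra_notT nexy.
    rewrite negb_exists => /forallP eqr.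
    by apply/ffunP => r; rewrite !ffunE; apply/eqP/negPn/eqr.
  by rewrite (bigD1 r) //= (negPf nr) mul0r.
rewrite !indicator -big_split; apply: eq_bigr => r _ /=.
by rewrite corner_L1 -mulnb natrM.
Qed.

Lemma sum_indicator (R : pzSemiRingType) (T : finType) (P : pred T) (a : T) :
  \sum_(x | P x) (x == a)%:R = (P a)%:R :> R.
Proof.
rewrite big_mkcond (bigD1 a) //= eqxx big1 ?addr0; first by case: (P a).
by move=> x /negPf ->; rewrite if_same.
Qed.

Theorem proposition2p5 (R : realFieldType) (b1 b2 : R)
    (hb1 : 0 <= b1 <= 1) (hb2 : 0 <= b2 <= 1)
    (n m : nat) (hn : (1 <= n)%N) (hm : (1 <= m)%N) (hmn : (m <= n)%N)
    (i0 j0 k0 l0 : {ffun 'I_m -> bool})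
    (i j : {ffun 'I_n -> bool}) :
  restr hmn i = i0 -> restr hmn j = j0 ->
  \sum_(k : {ffun 'I_n -> bool} | restr hmn k == k0)
    \sum_(l : {ffun 'I_n -> bool} | restr hmn l == l0) L b1 b2 i j k l
  = L b1 b2 i0 j0 k0 l0.
Proof.
move=> <- <-; rewrite L_corners.
under eq_bigr => k _ do
  (under eq_bigr => l _ do rewrite L_corners; rewrite exchange_big /=).
rewrite exchange_big /=; apply: eq_bigr => e _.
under eq_bigr => k _ do rewrite -mulr_sumr.
rewrite -mulr_sumr; congr (_ * _).
rewrite (eq_bigr _ (fun k _ => eq_bigr _ (fun l _ => prod_L1 R e i j k l))).
rewrite -big_distrlr /= !sum_indicator prod_L1 !restr_outputs.
by rewrite [outputs _ _ _ == k0]eq_sym [outputs _ _ _ == l0]eq_sym.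
Qed.
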